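(* Let $\mathbf P=(P,\leq,0,1)$ be a bounded poset satisfying the Ascending Chain Condition and let $\rightarrow$ be a binary operator on $P$, i.e. a map assigning to each pair $(x,y)\in P\times P$ a subset $x\rightarrow y$ of $P$. Then the following conditions (1) and (2) are equivalent: (1) $x\rightarrow y=\operatorname{Max}\{z\in P\mid L(x,z)\leq y\}$ for all $x,y\in P$. (2) The operator $\rightarrow$ satisfies the following conditions for all $x,y,z\in P$: (R1) $x\rightarrow y$ is an antichain, (R2) $L(x,z)\leq y$ implies $z\leq_1x\rightarrow y$, (R3) $\Lambda(x,x\rightarrow y)=L(x,y)$.
   Context: A poset is bounded if it has a bottom element $0$ and a top element $1$. The Ascending Chain Condition (ACC) says that there is no infinite strictly ascending chain. Singletons are identified with their unique element, i.e. $x$ is written for $\{x\}$. For $a,b\in P$ and subsets $A,B\subseteq P$: $\operatorname{Max}A$ is the set of all maximal elements of $A$; $L(a,b):=\{x\in P\mid x\leq a\text{ and }x\leq b\}$; $\Lambda(A,B):=\bigcup_{x\in A,\,y\in B}L(x,y)$; $A\leq B$ means $x\leq y$ for all $x\in A$ and all $y\in B$; $A\leq_1B$ means that for every $x\in A$ there exists $y\in B$ with $x\leq y$. In (R2), $z\leq_1x\rightarrow y$ means $\{z\}\leq_1(x\rightarrow y)$. *)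

(* Defs.v *)
From mathcomp Require Import all_boot all_order.
From mathcomp Require Import boolp classical_sets.

Set Implicit Arguments.
Unset Strict Implicit.
Unset Printing Implicit Defensive.

Import Order.TTheory.

Local Open Scope classical_set_scope.
Local Open Scope order_scope.

Definition ACC d (P : porderType d) : Prop :=
  ~ exists f : nat -> P, forall n, f n < f n.+1.

Definition Max d (P : porderType d) (A : set P) : set P :=
  [set m | A m /\ ~ exists2 a, A a & m < a].

Definition antichain d (P : porderType d) (A : set P) : Prop :=
  forall a b, A a -> A b -> a <> b -> a >< b.

Definition lower_cone d (P : porderType d) (a b : P) : set P :=
  [set x | x <= a /\ x <= b].

Definition Lambda d (P : porderType d) (A B : set P) : set P :=
  \bigcup_(x in A) \bigcup_(y in B) lower_cone x y.

Definition set_le d (P : porderType d) (A B : set P) : Prop :=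
  forall x y, A x -> B y -> x <= y.

Definition set_le1 d (P : porderType d) (A B : set P) : Prop :=
  forall x, A x -> exists2 y, B y & x <= y.

(* Main.v *)
Require Import Defs.
From mathcomp Require Import all_boot all_order.
From mathcomp Require Import boolp classical_sets.

Import Order.TTheory.

Local Open Scope classical_set_scope.
Local Open Scope order_scope.

(** Fix [x], [y] and let S be the set of [z] with L(x,z) below [y]. Given (1), ACC places a maximal
    element of S above each member of S ([Max_above]), which is (R2). Conversely, (R3) puts
    [imp x y] inside S and (R2) makes it cofinal in S; a cofinal antichain contained in S is exactly
    Max S. *)

(** Otherwise every element of [A] above [z] has a strictly larger one in [A], and iterating a
    choice function from [z] violates ACC. *)
Lemma Max_above d (P : porderType d) (A : set P) (z : P) :
  ACC P -> A z -> exists2 m, Max A m & z <= m.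
Proof.
move=> acc Az; apply: contrapT => nomax; apply: acc.
have /choice[f fP] (a : P) :
    exists b, A a /\ z <= a -> [/\ A b, z <= b & a < b].
  have [[Aa za]|] := pselect (A a /\ z <= a); last by exists a.
  have [[b Ab ab]|nob] := pselect (exists2 b, A b & a < b).
    by exists b => _; split=> //; apply: le_trans za (ltW ab).
  by case: nomax; exists a.
have itP n : A (iter n f z) /\ z <= iter n f z.
  by elim: n => [|n /fP[]].
by exists (fun n => iter n f z) => n; have [] := fP _ (itP n).
Qed.

Lemma antichain_Max d (P : porderType d) (A : set P) : antichain (Max A).
Proof.
move=> a b [Aa maxa] [Ab maxb] /eqP neq_ab; rewrite /Order.comparable.
apply/negP => /orP[] le_ab.
- by apply: maxa; exists b => //; rewrite lt_neqAle neq_ab.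
- by apply: maxb; exists a => //; rewrite lt_neqAle eq_sym neq_ab.
Qed.

Theorem theorem4p3 (d : Order.disp_t) (P : tbPOrderType d)
    (acc : ACC P) (imp : P -> P -> set P) :
  (forall x y : P,
     imp x y = Max [set z | set_le (lower_cone x z) [set y]])
  <->
  (forall x y z : P,
     [/\ antichain (imp x y),
         set_le (lower_cone x z) [set y] -> set_le1 [set z] (imp x y)
       & Lambda [set x] (imp x y) = lower_cone x y]).
Proof.
split=> [impE x y z | R x y].
  have R2 w : set_le (lower_cone x w) [set y] -> set_le1 [set w] (imp x y).
    by move=> xwy _ ->; rewrite impE; apply: Max_above.
  split; [by rewrite impE; apply: antichain_Max | exact: R2 |].
  apply/seteqP; split=> w.
    case=> _ -> [m]; rewrite impE => -[xmy _] [wx wm].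
    by split=> //; apply: xmy.
  case=> wx wy.
  (* Since [w <= y], [w] itself belongs to S, so (R2) supplies the member of [imp x y] needed above
     it. *)
  have xwy : set_le (lower_cone x w) [set y].
    by move=> u _ [_ uw] ->; apply: le_trans wy.
  by have [m xym wm] := R2 w xwy w erefl; exists x => //; exists m.
have sub m : imp x y m -> set_le (lower_cone x m) [set y].
  move=> xym w _ [wx wm] ->; have [_ _ R3] := R x y m.
  have : Lambda [set x] (imp x y) w by exists x => //; exists m.
  by rewrite R3 => -[].
apply/seteqP; split=> m.
  (* A larger [a] in S would lie below some [b] in [imp x y], making [m < b] comparable inside an
     antichain. *)
  move=> xym; split=> [|[a xay ma]]; first exact: sub.
  have [anti R2 _] := R x y a; have [b xyb ab] := R2 xay a erefl.
  have mb : m < b := lt_le_trans ma ab.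
  have neq : m <> b by move=> mE; move: mb; rewrite mE ltxx.
  by have := anti m b xym xyb neq; rewrite /Order.comparable (ltW mb).
(* (R2) gives [b] in [imp x y] above [m]; as [b] is in S by [sub], maximality forces [m = b]. *)
case=> xmy maxm; have [_ R2 _] := R x y m.
have [b xyb] := R2 xmy m erefl.
rewrite le_eqVlt => /orP[/eqP-> // | mb].
by case: maxm; exists b => //; apply: sub.
Qed.
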